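(* Let $n=2$ and let $R:\mathbb{R}\to(0,\infty)$ be a smooth positive function. For real $l$ consider the wave map system for $u=(u^1,u^2)$, $u^2(t,x)>0$, $t\in\mathbb{R}$, $x\in\mathbb{R}^2$: $$\partial_t^2u^1+n\frac{R'}{R}\partial_tu^1-R^{-2}\Delta u^1-\frac{l}{u^2}\partial_tu^1\,\partial_tu^2+R^{-2}\frac{l}{u^2}\nabla_xu^1\cdot\nabla_xu^2=0,$$ $$\partial_t^2u^2+n\frac{R'}{R}\partial_tu^2-R^{-2}\Delta u^2+\frac{l}{2u^2}\left((\partial_tu^1)^2-(\partial_tu^2)^2\right)-R^{-2}\frac{l}{2u^2}\left(|\nabla_xu^1|^2-|\nabla_xu^2|^2\right)=0.$$ (i) If $0\le l<2$, then the only stationary (i.e. $t$-independent) solutions of this system with $u^2>0$ and with finite integral $$\int_{\mathbb{R}^2}\sum_{\alpha=1}^2\left(\left[\frac{\partial_\alpha u^1}{(u^2)^{l/2}}\right]^2+\left[\frac{\partial_\alpha u^2}{(u^2)^{l/2}}\right]^2\right)dx<\infty$$ are the constant solutions $u^1\equiv c_1$, $u^2\equiv c_2>0$. (ii) If $l=2$, then the only stationary spherically symmetric wave maps (stationary spherically symmetric solutions of the system with $u^2>0$) for which the integral in (i), with $l=2$, is finite are the constant wave maps.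
   Context: Superscripts on $u$ are component indices, while $(u^2)^{l/2}$ is a power of the component $u^2$. $\Delta$ and $\nabla_x$ are the Euclidean Laplacian and gradient in $x\in\mathbb{R}^2$, and $\partial_\alpha=\partial/\partial x_\alpha$. Solutions are classical (smooth). The system is the wave map equation from $\mathbb{R}^2\times\mathbb{R}$ with the metric $-dt^2+R^2(t)\left((dx^1)^2+(dx^2)^2\right)$ into the half-plane $\{(u^1,u^2)\in\mathbb{R}^2:u^2>0\}$ with the metric $\frac{1}{(u^2)^l}\left((du^1)^2+(du^2)^2\right)$; for $l=2$ the target is the hyperbolic plane $\mathbb{H}^2$. Spherically symmetric means that $u^1,u^2$ depend on $x$ only through $|x|$. *)

(* Defs.v *)
From mathcomp Require Import all_boot all_order all_algebra.
From mathcomp Require Import all_classical all_reals all_analysis.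

Set Implicit Arguments.
Unset Strict Implicit.
Unset Printing Implicit Defensive.

Import Order.TTheory GRing.Theory Num.Theory.
Import numFieldNormedType.Exports.

Local Open Scope classical_set_scope.
Local Open Scope ring_scope.

(* On a finite-dimensional [V], continuity of every directional derivative is
   equivalent to the usual continuity of the differential. *)
Fixpoint Ck (K : realType) (V W : normedModType K) (k : nat) (f : V -> W)
    : Prop :=
  match k with
  | 0 => continuous f
  | k'.+1 => [/\ continuous f,
                 forall x v, derivable f x v
               & forall v, Ck k' (fun x => 'D_v f x)]
  end.

Definition smooth (K : realType) (V W : normedModType K) (f : V -> W) : Prop :=
  forall k, Ck k f.

Section WaveMap.
Variable K : realType.

(* Points of space-time are pairs (t, (x_1, x_2)).  The library norm on a
   product is the sup norm, hence the explicit Euclidean norm below. *)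
Definition enorm (x : K * K) : K := Num.sqrt (x.1 ^+ 2 + x.2 ^+ 2).

Definition dt (f : K * (K * K) -> K) : K * (K * K) -> K :=
  fun p => 'D_((1, (0, 0)) : K * (K * K)) f p.
Definition dx1 (f : K * (K * K) -> K) : K * (K * K) -> K :=
  fun p => 'D_((0, (1, 0)) : K * (K * K)) f p.
Definition dx2 (f : K * (K * K) -> K) : K * (K * K) -> K :=
  fun p => 'D_((0, (0, 1)) : K * (K * K)) f p.

Definition laplacian (f : K * (K * K) -> K) (p : K * (K * K)) : K :=
  dx1 (dx1 f) p + dx2 (dx2 f) p.

Definition grad_dot (f g : K * (K * K) -> K) (p : K * (K * K)) : K :=
  dx1 f p * dx1 g p + dx2 f p * dx2 g p.

(* The coefficient 2 of R'/R is the space dimension n. *)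
Definition wave_map_system (R : K -> K) (l : K)
    (u1 u2 : K * (K * K) -> K) : Prop :=
  forall p : K * (K * K), let t := p.1 in
    dt (dt u1) p + 2 * (derive1 R t / R t) * dt u1 p
      - R t ^- 2 * laplacian u1 p
      - l / u2 p * dt u1 p * dt u2 p
      + R t ^- 2 * (l / u2 p) * grad_dot u1 u2 p = 0
    /\
    dt (dt u2) p + 2 * (derive1 R t / R t) * dt u2 p
      - R t ^- 2 * laplacian u2 p
      + l / (2 * u2 p) * (dt u1 p ^+ 2 - dt u2 p ^+ 2)
      - R t ^- 2 * (l / (2 * u2 p)) *
          (grad_dot u1 u1 p - grad_dot u2 u2 p) = 0.

Definition classical_solution (R : K -> K) (l : K)
    (u1 u2 : K * (K * K) -> K) : Prop :=
  [/\ smooth u1, smooth u2, forall p, 0 < u2 p & wave_map_system R l u1 u2].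

Definition stationary (f : K * (K * K) -> K) : Prop :=
  forall s t x, f (s, x) = f (t, x).

Definition spherically_symmetric (f : K * (K * K) -> K) : Prop :=
  forall t x y, enorm x = enorm y -> f (t, x) = f (t, y).

Definition energy_density (l : K) (u1 u2 : K * (K * K) -> K)
    (p : K * (K * K)) : K :=
  ((dx1 u1 p / u2 p `^ (l / 2)) ^+ 2 + (dx1 u2 p / u2 p `^ (l / 2)) ^+ 2)
  + ((dx2 u1 p / u2 p `^ (l / 2)) ^+ 2 + (dx2 u2 p / u2 p `^ (l / 2)) ^+ 2).

Definition energy (l : K) (u1 u2 : K * (K * K) -> K) (t : K) : \bar K :=
  (\int[(@lebesgue_measure K \x @lebesgue_measure K)%E]_x
     (energy_density l u1 u2 (t, x))%:E)%E.

Definition constant_map (u1 u2 : K * (K * K) -> K) : Prop :=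
  exists c1 c2 : K, 0 < c2 /\ forall p, u1 p = c1 /\ u2 p = c2.

End WaveMap.

(* Main.v *)
Require Import Defs.
From mathcomp Require Import all_boot all_order all_algebra.
From mathcomp Require Import all_classical all_reals all_analysis.
From mathcomp Require Import measurable_realfun ring lra.

(** Stationary solutions are harmonic maps from the Euclidean plane to the
half-plane, the factors in R cancelling.  Write x for u1 and y for u2, so that
[Delta x = (l/y) grad x . grad y] and
[Delta y = (l/2y) (|grad y|^2 - |grad x|^2)].

For l < 2 put b = (2 - l)/4 > 0.  The second equation gives
[Delta (y^b) = - b y^(b-2) (b |grad y|^2 + (l/2) |grad x|^2) <= 0], so y^b is a
positive superharmonic function on the whole plane.  Such functions are
constant ([positive_superharmonic_cst]): by comparison with a multiple of a
function that grows like log |z - p|, the infimum over the plane is approached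
inside every disc around p, however small, hence is the value at p.  Thus y is
constant.  If l > 0 the second equation now reads |grad x|^2 = 0.  If l = 0,
then x is harmonic with finite Dirichlet integral; this is where the energy is
used.  By Tonelli, on each scale N there are horizontal and vertical lines at
distance between N and 2N from the axes on which the integral of |grad x|^2 is
at most C/N.  By Cauchy-Schwarz x then oscillates on the boundary of the
rectangle between these lines by an amount independent of N (the
Courant-Lebesgue argument), and by the maximum principle it does so inside.  So
x is bounded, and the Liouville property applies to x plus a constant
([harmonic_finite_dirichlet_cst]).

For l = 2 and radial maps the system is an ordinary differential equation in
the radius r, whose conserved quantity [r^2 (x'^2 + y'^2) / y^2] is the radial
part of the Hopf differential.  It vanishes at r = 0, so x' = y' = 0
([radial_gradient_eq0]).

The maximum principles only need second derivatives along the two coordinate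
lines; [is_jet2] records these. *)

Set Implicit Arguments.
Unset Strict Implicit.
Import Order.TTheory GRing.Theory Num.Theory.
Import numFieldNormedType.Exports.
Local Open Scope classical_set_scope.
Local Open Scope ring_scope.

(** * Second directional derivatives *)

Section Jets.
Variables (K : realType) (V : normedModType K).
Implicit Types (f g : V -> K) (p v : V) (c d s : K).

(** Directional derivatives are one-variable derivatives along a line, which
gives access to the chain rule and the mean value theorem of one variable. *)
Lemma is_derive_lineP f p v s d :
  is_derive (s *: v + p) v f d <-> is_derive s 1 (fun s : K => f (s *: v + p)) d.
Proof.
have E : (fun h : K => h^-1 *: ((f \o shift (s *: v + p)) (h *: v) - f (s *: v + p)))
   = (fun h : K => h^-1 *: (((fun s : K => f (s *: v + p)) \o shift s) (h *: 1)
       - f (s *: v + p))).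
  by apply/funext => h /=; rewrite [h *: 1]mulr1 scalerDl addrA.
by split=> -[ex val]; split; move: ex val; rewrite /derivable /derive E.
Qed.

Lemma is_derive_line0P f p v d :
  is_derive p v f d <-> is_derive (0:K) 1 (fun s : K => f (s *: v + p)) d.
Proof. by rewrite -is_derive_lineP scale0r add0r. Qed.

Lemma near_line p v (P : V -> Prop) :
  (\forall q \near p, P q) -> \forall s \near (0 : K), P (s *: v + p).
Proof.
move=> nP; have : (fun s : K => s *: v + p) @ (0:K) --> p.
  rewrite -[X in _ --> X](add0r p) -[X in _ --> X + _](scale0r v).
  by apply: cvgD; [apply: cvgZr_tmp; exact: cvg_id|exact: cvg_cst].
exact.
Qed.

Lemma is_derive_dircomp (h : K -> K) f p v a d :
  is_derive (f p) 1 h a -> is_derive p v f d ->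
  is_derive p v (h \o f) (a * d).
Proof.
move=> dh /is_derive_line0P df; apply/is_derive_line0P.
apply: (@is_derive1_comp _ h (fun s : K => f (s *: v + p))) => //.
by rewrite scale0r add0r.
Qed.

(** The first two derivatives [d] and [c] of [f] at [p] along [v].  Being a
relation that only looks at [f] near [p], it passes through sums and
compositions with functions that are differentiable on part of the line only,
such as logarithms and powers. *)
Definition is_jet2 f p v d c := exists D : V -> K,
  [/\ D p = d, \forall q \near p, is_derive q v f (D q) & is_derive p v D c].

Lemma is_jet2D f g p v d c d' c' :
  is_jet2 f p v d c -> is_jet2 g p v d' c' ->
  is_jet2 (f + g) p v (d + d') (c + c').
Proof.
move=> [D [<- Df Dc]] [E [<- Eg Ec]]; exists (D + E); split => //.
  by near=> q; apply: is_deriveD; near: q.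
exact: is_deriveD.
Unshelve. all: by end_near. Qed.

Lemma is_jet2Z f p v d c k :
  is_jet2 f p v d c -> is_jet2 (k *: f) p v (k * d) (k * c).
Proof.
move=> [D [<- Df Dc]]; exists (k *: D); split => //.
  by near=> q; apply: is_deriveZ; near: q.
exact: is_deriveZ.
Unshelve. all: by end_near. Qed.

Lemma is_jet2_cst p v k : is_jet2 (cst k) p v 0 0.
Proof.
exists (cst 0); split => //; last exact: is_derive_cst.
by near=> q; exact: is_derive_cst.
Unshelve. all: by end_near. Qed.

Lemma is_jet2_comp (h h1 : K -> K) h2 f p v d c :
  (\forall q \near p, is_derive (f q) 1 h (h1 (f q))) ->
  is_derive (f p) 1 h1 h2 ->
  is_jet2 f p v d c ->
  is_jet2 (h \o f) p v (h1 (f p) * d) (h2 * d ^+ 2 + h1 (f p) * c).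
Proof.
move=> dh dh1 [D [<- Df Dc]]; exists ((h1 \o f) * D); split => //.
  by near=> q; apply: is_derive_dircomp; near: q.
have dfp : is_derive p v f (D p) by exact: (nbhs_singleton Df).
have H := is_derive_dircomp dh1 dfp.
have := is_deriveM H Dc; move=> X; apply: (is_derive_eq X) => /=.
by rewrite !/(_ *: _)/=; ring.
Unshelve. all: by end_near. Qed.

(** At a minimum the first derivative vanishes; if the second were negative, the
first derivative would be negative just after the minimum, and the mean value
theorem would give a smaller value. *)
Lemma jet2_min f p v d c : (\forall q \near p, f p <= f q) ->
  is_jet2 f p v d c -> 0 <= c.
Proof.
move=> pmin [D [Dp Df Dc]]; rewrite leNgt; apply/negP => c0.
pose phi (s : K) := f (s *: v + p); pose psi (s : K) := D (s *: v + p).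
have phi0 : phi 0 = f p by rewrite /phi scale0r add0r.
have psi0 : psi 0 = D p by rewrite /psi scale0r add0r.
have dphi : \forall s \near (0:K), is_derive (s : K) 1 phi (psi s) /\ phi 0 <= phi s.
  apply: filterS (near_line v (filterI Df pmin)) => s [H1 H2].
  by split; [exact/is_derive_lineP|rewrite phi0].
have dpsi : is_derive (0:K) 1 psi c by exact/is_derive_line0P.
have [e /= e0 He] := dphi.
have {}He (s : K) : `|s| < e -> is_derive s 1 phi (psi s) /\ phi 0 <= phi s.
  by move=> se; apply: He; rewrite /ball/= sub0r normrN.
have psi00 : psi 0 = 0.
  have d0 : is_derive (0:K) 1 phi (psi 0) by apply: (proj1 (He _ _)); rewrite normr0.
  have : is_derive (0:K) 1 phi 0.
    apply: (@derive1_at_min _ phi (-e) e 0).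
    - by rewrite ge0_cp // ltW.
    - move=> t; rewrite in_itv /= => /andP[t1 t2].
      by have [[]] := He t ltac:(by rewrite ltr_norml t1).
    - by rewrite in_itv /= oppr_lt0 e0.
    - move=> t; rewrite in_itv /= => /andP[t1 t2].
      by have [] := He t ltac:(by rewrite ltr_norml t1).
  by move=> [_ h1]; case: d0 => _; rewrite h1.
have [ex val] := dpsi.
have : \forall h \near (0:K)^', h^-1 *: (psi h - psi 0) < 0.
  have cv : (fun h : K => h^-1 *: (psi h - psi 0)) @ (0:K)^' --> c.
    rewrite -val; have := ex; rewrite /derivable /derive.
    have -> : (fun h : K => h^-1 *: ((psi \o shift 0) (h *: 1) - psi 0))
           = (fun h : K => h^-1 *: (psi h - psi 0)).
      by apply/funext => h /=; rewrite [h *: 1]mulr1 addr0.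
    by [].
  by apply: (cv [set y | y < 0]); exact: lt_nbhsl.
move=> [e' /= e'0 He'].
pose m := Num.min e e' / 2.
have mm : 0 < Num.min e e' by rewrite lt_min e0.
have m0 : 0 < m by rewrite divr_gt0.
have mlt : m < Num.min e e' by rewrite /m; lra.
move: mlt; rewrite lt_min => /andP[me me'].
have dm x : x \in `]0, m[ -> is_derive x 1 phi (psi x).
  rewrite in_itv /= => /andP[x0 xm].
  by have [] := He x ltac:(by rewrite gtr0_norm ?(lt_trans xm)).
have cm : {within `[0, m], continuous phi}.
  apply: derivable_within_continuous => x; rewrite in_itv /= => /andP[x0 xm].
  by have [[]] := He x ltac:(by rewrite ger0_norm ?(le_lt_trans xm)).
have [t] := MVT m0 dm cm; rewrite in_itv /= => /andP[t0 tm] E.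
have := He' t; rewrite /ball/= sub0r normrN gtr0_norm // (lt_trans tm) //.
move=> /(_ erefl); rewrite gt_eqF // => /(_ erefl).
rewrite psi00 subr0 pmulr_rlt0 ?invr_gt0 // => psit.
have [_] := He m ltac:(by rewrite gtr0_norm).
rewrite leNgt => /negP; apply.
by rewrite -subr_lt0 E subr0 pmulr_llt0.
Unshelve. all: by end_near. Qed.

End Jets.

(** * Positive superharmonic functions on the plane *)

Section Liouville.
Variable K : realType.
Implicit Types (f g w : K * K -> K) (p q z : K * K).

Definition e1 : K * K := (1, 0).
Definition e2 : K * K := (0, 1).

(** The minimum over a compact set cannot be at a point where the Laplacian is
negative, by the second derivative test along both axes; so it is at one of the
points where the bound is known. *)
Lemma weak_min_principle (A : set (K * K)) g (mu : K) :
  compact A -> (forall p, A p -> {for p, continuous g}) ->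
  (forall p, A p -> mu <= g p \/ nbhs p A /\ exists d1 c1 d2 c2,
     [/\ is_jet2 g p e1 d1 c1, is_jet2 g p e2 d2 c2 & c1 + c2 < 0]) ->
  forall p, A p -> mu <= g p.
Proof.
move=> cA cg H p Ap.
have [|q /[!inE] Aq qmin] := compact_EVT_min (ex_intro _ p Ap) cA (f := g).
  by apply: continuous_in_subspaceT => x /[!inE]; exact: cg.
have qmin' z : A z -> g q <= g z by move=> Az; apply: qmin; rewrite inE.
apply: le_trans (qmin' _ Ap).
have [//|[nA [d1 [c1 [d2 [c2 [J1 J2 c12]]]]]]] := H _ Aq.
have nq : \forall z \near q, g q <= g z by apply: filterS nA.
have := jet2_min nq J1; have := jet2_min nq J2; lra.
Qed.

Lemma nbhs_rectangle (a b c d : K) p : a < p.1 < b -> c < p.2 < d ->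
  nbhs p (`[a, b] `*` `[c, d]).
Proof.
move=> p1 p2; exists (`[a, b]%classic, `[c, d]%classic) => //=.
by split; apply: filterS (near_in_itvoo _) => //=; try exact: subset_itv_oo_cc; rewrite in_itv.
Qed.

Definition sqdist (a p : K * K) : K := (p.1 - a.1) ^+ 2 + (p.2 - a.2) ^+ 2.

Lemma is_jet2_sqdist a p :
  is_jet2 (sqdist a) p e1 (2 * (p.1 - a.1)) 2 /\
  is_jet2 (sqdist a) p e2 (2 * (p.2 - a.2)) 2.
Proof.
split.
- exists (fun q => 2 * (q.1 - a.1)); split => //.
    near=> q; apply/is_derive_line0P; rewrite /sqdist/=.
    apply: is_derive_eq; rewrite /= !/(_ *: _) /=; ring.
  apply/is_derive_line0P => /=; apply: is_derive_eq; rewrite /= !/(_ *: _) /=; ring.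
- exists (fun q => 2 * (q.2 - a.2)); split => //.
    near=> q; apply/is_derive_line0P; rewrite /sqdist/=.
    apply: is_derive_eq; rewrite /= !/(_ *: _) /=; ring.
  apply/is_derive_line0P => /=; apply: is_derive_eq; rewrite /= !/(_ *: _) /=; ring.
Unshelve. all: by end_near. Qed.

Lemma continuous_sqdist a : continuous (sqdist a).
Proof.
move=> p; rewrite /sqdist.
apply: cvgD; apply: cvgM; (apply: cvgB; last exact: cvg_cst).
- exact: cvg_fst. 
- exact: cvg_fst.
- exact: cvg_snd.
- exact: cvg_snd.
Qed.

(** As a function of [s = |z - a|^2] this grows like a multiple of [log |z - a|].
The logarithm alone is harmonic; the second term makes the sum strictly
superharmonic, so that the weak minimum principle applies to small multiples of
it added to a superharmonic function. *)
Definition barrier (s : K) := ln s - s^-1.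

Lemma is_derive_barrier (s : K) : 0 < s -> is_derive s 1 barrier (s^-1 + s ^- 2).
Proof.
move=> s0; have H := is_derive1_ln s0.
have s1 : s != 0 by rewrite gt_eqF.
have H2 := is_deriveV s1 (is_derive_id s (1:K)).
have := is_deriveB H H2; move=> X; apply: (is_derive_eq X).
by rewrite /(_ *: _) /= mulr1 opprK.
Qed.

Lemma is_derive_barrier1 (s : K) : 0 < s ->
  is_derive s 1 (fun s : K => s^-1 + s ^- 2) (- s ^- 2 - 2 * s ^- 3).
Proof.
move=> s0; have s1 : s != 0 by rewrite gt_eqF.
have H1 := is_deriveV s1 (is_derive_id s (1:K)).
have s2 : s ^+ 2 != 0 by rewrite expf_neq0.
have H2 := is_deriveV (f := id ^+ 2 : K -> K) s2 (is_deriveX 2 (is_derive_id s (1:K))).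
have := is_deriveD H1 H2; move=> X; apply: (is_derive_eq X).
by rewrite /= !/(_ *: _) /= !mulr1 (_ : (id ^+ 2 : K -> K) s = s ^+ 2) //; field.
Qed.

Lemma is_jet2_barrier a p : 0 < sqdist a p -> exists d1 c1 d2 c2,
  [/\ is_jet2 (barrier \o sqdist a) p e1 d1 c1,
      is_jet2 (barrier \o sqdist a) p e2 d2 c2 & c1 + c2 < 0].
Proof.
move=> s0; have [J1 J2] := is_jet2_sqdist a p.
have near_pos : \forall q \near p, is_derive (sqdist a q) 1 barrier
   ((fun s : K => s^-1 + s ^- 2) (sqdist a q)).
  have : \forall q \near p, 0 < sqdist a q.
    exact: (cvgr_gt _ (continuous_sqdist (a := a) (x := p)) _ s0).
  by apply: filterS => q; exact: is_derive_barrier.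
have dd := is_derive_barrier1 s0.
have K1 := is_jet2_comp near_pos dd J1.
have K2 := is_jet2_comp near_pos dd J2.
do 4 eexists; split; [exact: K1|exact: K2|].
have s1 : sqdist a p != 0 by rewrite gt_eqF.
rewrite [X in X < 0](_ : _ = - (4 * sqdist a p ^- 2)).
  by rewrite oppr_lt0 mulr_gt0 // invr_gt0 exprn_gt0.
by move: s1; rewrite /sqdist => s1; field.
Qed.

Definition superharmonic w := continuous w /\
  forall p, exists d1 c1 d2 c2,
     [/\ is_jet2 w p e1 d1 c1, is_jet2 w p e2 d2 c2 & c1 + c2 <= 0].

(** Suppose [w q < mu < w p].  Around [p] there is a disc on which [w > mu].
Add to [w] a small multiple of the barrier, normalised to vanish on the circle
bounding the disc.  The sum is still below [mu] at [q], but above [mu] on the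
circle and, since [w > 0] and the barrier tends to infinity, far away: this
contradicts the minimum principle on the region in between. *)
Lemma positive_superharmonic_cst w : superharmonic w ->
  (forall p, 0 < w p) -> forall p q, w p = w q.
Proof.
move=> [cw Jw] w0.
suff le p q : w p <= w q by move=> p q; apply/eqP; rewrite eq_le !le.
rewrite leNgt; apply/negP => wqp.
pose mu := (w p + w q) / 2.
have [mup qmu] : mu < w p /\ w q < mu by rewrite /mu; split; lra.
have [e /= e0 He] := (nbhs_ballP _ _).1 (cvgr_gt _ (cw p) _ mup).
(* [e] is a radius for the sup norm; the Euclidean disc of squared radius [S0]
   lies in that square. *)
pose S0 := (e / 2) ^+ 2.
have S0_gt0 : 0 < S0 by rewrite exprn_gt0 // divr_gt0.
have inner z : sqdist p z <= S0 -> mu < w z.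
  rewrite /sqdist /S0 => le; apply: He.
  have e20 : 0 <= e / 2 by rewrite divr_ge0 // ltW.
  have h1 : `|z.1 - p.1| <= e / 2.
    rewrite -(@ler_pXn2r _ 2) ?nnegrE // real_normK ?num_real //.
    by apply: le_trans le; rewrite lerDl sqr_ge0.
  have h2 : `|z.2 - p.2| <= e / 2.
    rewrite -(@ler_pXn2r _ 2) ?nnegrE // real_normK ?num_real //.
    by apply: le_trans le; rewrite lerDr sqr_ge0.
  by split; rewrite /ball /= distrC; lra.
have Sq : S0 < sqdist p q.
  by rewrite ltNge; apply/negP => /inner; rewrite ltNge ltW.
pose B z := barrier (sqdist p z) - barrier S0.
(* Small enough for the sum to stay below [mu] at [q]. *)
pose ep := (mu - w q) / (1 + `|B q|).
have B1 : 0 < 1 + `|B q| by rewrite ltr_pwDl.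
have ep0 : 0 < ep by rewrite divr_gt0 // subr_gt0.
have epq : w q + ep * B q < mu.
  have : ep * (1 + `|B q|) = mu - w q by rewrite /ep divfK // gt_eqF.
  have := ler_norm (B q); nra.
(* For [s >= L] and [s >= 1], [ep * (barrier s - barrier S0) >= mu]. *)
pose L := expR (mu / ep + barrier S0 + 1).
have L0 : 0 < L := expR_gt0 _.
pose rho := 1 + L + `|q.1 - p.1| + `|q.2 - p.2|.
have n1 := normr_ge0 (q.1 - p.1); have n2 := normr_ge0 (q.2 - p.2).
have outer z : rho <= `|z.1 - p.1| \/ rho <= `|z.2 - p.2| -> mu <= ep * B z.
  move=> H; have LS : L + 1 <= sqdist p z.
    rewrite /sqdist; have := sqr_ge0 (z.1 - p.1); have := sqr_ge0 (z.2 - p.2).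
    rewrite -![(z.1 - _) ^+ 2]real_normK ?num_real // -![(z.2 - _) ^+ 2]real_normK ?num_real //.
    by case: H; rewrite /rho; nra.
  have S1 : 0 < sqdist p z by lra.
  have : ln L <= ln (sqdist p z) by rewrite ler_ln ?posrE//; lra.
  rewrite expRK => lnS.
  have : (sqdist p z)^-1 <= 1 by rewrite invf_le1 //; lra.
  move=> invS.
  have : mu / ep <= B z by rewrite /B {1}/barrier; lra.
  by rewrite ler_pdivrMr // mulrC.
pose A := (`[p.1 - rho, p.1 + rho] `*` `[p.2 - rho, p.2 + rho]) `&`
          [set z | S0 <= sqdist p z].
have cA : compact A.
  apply: compact_closedI; first by apply: compact_setX; exact: segment_compact.
  apply: (@preimage_closed _ _ (sqdist p) [set y | S0 <= y]).
    by move=> x _; exact: continuous_sqdist.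
  exact: closed_ge.
pose g := w + ep *: (barrier \o sqdist p + cst (- barrier S0)).
have gE z : g z = w z + ep * B z by [].
have jg z : 0 < sqdist p z -> exists d1 c1 d2 c2,
     [/\ is_jet2 g z e1 d1 c1, is_jet2 g z e2 d2 c2 & c1 + c2 < 0].
  move=> z0; have [d1 [c1 [d2 [c2 [J1 J2 c12]]]]] := Jw z.
  have [d1' [c1' [d2' [c2' [J1' J2' c12']]]]] := is_jet2_barrier z0.
  have M1 := is_jet2D J1 (is_jet2Z ep (is_jet2D J1' (is_jet2_cst z e1 (- barrier S0)))).
  have M2 := is_jet2D J2 (is_jet2Z ep (is_jet2D J2' (is_jet2_cst z e2 (- barrier S0)))).
  do 4 eexists; split; [exact: M1|exact: M2|].
  have : ep * (c1' + c2') < 0 by rewrite pmulr_rlt0.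
  by rewrite mulrDr; lra.
have Aq : A q.
  rewrite /A /= !in_itv /=; split; last exact: ltW.
  have := ler_norm (q.1 - p.1); have := ler_norm (q.2 - p.2).
  have := lerNnormlW (lexx `|q.1 - p.1|); have := lerNnormlW (lexx `|q.2 - p.2|).
  by move=> *; split; apply/andP; split; rewrite /rho; lra.
suff : mu <= g q by rewrite gE leNgt epq.
apply: (weak_min_principle cA) => // [z Az|z [Az1 Az2]].
  have z0 : 0 < sqdist p z by apply: lt_le_trans S0_gt0 _; case: Az.
  rewrite /g; apply: continuousD; first exact: cw.
  apply: continuousZr; apply: continuousD; last exact: cst_continuous.
  apply: continuous_comp; first exact: continuous_sqdist.
  apply: differentiable_continuous; apply/derivable1_diffP.
  by have [] := is_derive_barrier z0.
rewrite gE.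
have z0 : 0 < sqdist p z by exact: lt_le_trans S0_gt0 _.
have wz := w0 z.
case: (lerP rho `|z.1 - p.1|) => o1.
  by left; have := outer z (or_introl o1); lra.
case: (lerP rho `|z.2 - p.2|) => o2.
  by left; have := outer z (or_intror o2); lra.
have [Sz|Sz] := lerP (sqdist p z) S0.
  have -> : B z = 0 by rewrite /B (_ : sqdist p z = S0) ?subrr //; apply/le_anti/andP.
  by left; rewrite mulr0 addr0 ltW // inner.
right; split; last exact: jg.
apply: filterI.
  move: o1 o2; rewrite !ltr_norml => /andP[? ?] /andP[? ?].
  by apply: nbhs_rectangle; apply/andP; split; lra.
have X : \forall y \near z, S0 < sqdist p y := cvgr_gt _ (continuous_sqdist (a := p) (x := z)) _ Sz.
by near=> y => /=; apply: ltW; near: y; exact: X.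
Unshelve. all: by end_near.
Qed.

End Liouville.
Arguments e1 {K}.
Arguments e2 {K}.

(** * Rectangles and lines *)

Section HarmonicRectangle.
Variable K : realType.
Implicit Types (f g w : K * K -> K) (p q z : K * K).

Lemma superharmonicDcst f (k : K) : superharmonic f -> superharmonic (f + cst k).
Proof.
move=> [cf Jf]; split.
  by move=> p; apply: continuousD; [exact: cf|exact: cst_continuous].
move=> p; have [d1 [c1 [d2 [c2 [J1 J2 c12]]]]] := Jf p.
do 4 eexists; split; [exact: (is_jet2D J1 (is_jet2_cst p _ k))|
  exact: (is_jet2D J2 (is_jet2_cst p _ k))|by rewrite !addr0].
Qed.

(** Subtracting a small multiple of [|z|^2] makes the Laplacian strictly
negative. *)
Lemma superharmonic_min_rectangle f (a b c d m : K) : superharmonic f ->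
  (forall p, a <= p.1 <= b -> c <= p.2 <= d ->
     [\/ p.1 = a, p.1 = b, p.2 = c | p.2 = d] -> m <= f p) ->
  forall p, a <= p.1 <= b -> c <= p.2 <= d -> m <= f p.
Proof.
move=> [cf Jf] side z z1 z2; rewrite leNgt; apply/negP => fz.
pose M := (`|a| + `|b|) ^+ 2 + (`|c| + `|d|) ^+ 2.
have Mle p : a <= p.1 <= b -> c <= p.2 <= d -> sqdist (0, 0) p <= M.
  have aux (x y t : K) : x <= t <= y -> t ^+ 2 <= (`|x| + `|y|) ^+ 2.
    move=> /andP[xt ty]; rewrite -[t ^+ 2]real_normK ?num_real //.
    rewrite ler_pXn2r ?nnegrE ?addr_ge0 // ler_norml.
    have := ler_norm y; have := lerNnormlW (lexx `|x|).
    have := normr_ge0 x; have := normr_ge0 y.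
    by move=> *; apply/andP; split; lra.
  by move=> p1 p2; rewrite /sqdist /M !subr0; apply: lerD; exact: aux.
have M0 : 0 <= M by rewrite addr_ge0 // sqr_ge0.
pose ep := (m - f z) / (1 + M).
have M1 : 0 < 1 + M by rewrite ltr_pwDl.
have ep0 : 0 < ep by rewrite divr_gt0 // subr_gt0.
have epE : ep * (1 + M) = m - f z by rewrite /ep divfK // gt_eqF.
pose g := f + (- ep) *: sqdist (0, 0).
have gE p : g p = f p - ep * sqdist (0, 0) p by rewrite -mulNr.
suff : m - ep * M <= g z.
  rewrite gE; have : 0 <= sqdist (0,0) z by rewrite addr_ge0 // sqr_ge0.
  nra.
have cA : compact (`[a, b] `*` `[c, d]).
  by apply: compact_setX; exact: segment_compact.
apply: (weak_min_principle cA) => [p _|p [] /=|].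
- rewrite /g; apply: continuousD; first exact: cf.
  by apply: continuousZr; exact: continuous_sqdist.
- rewrite !in_itv /= => p1 p2.
  have sideg : [\/ p.1 = a, p.1 = b, p.2 = c | p.2 = d] -> m - ep * M <= g p.
    move=> /side => /(_ p1 p2); have := Mle p p1 p2; rewrite gE; nra.
  have [/andP[ap pb] /andP[cp pd]] := conj p1 p2.
  move: ap; rewrite le_eqVlt => /predU1P[ap|ap].
    by left; apply: sideg; constructor 1.
  move: pb; rewrite le_eqVlt => /predU1P[pb|pb].
    by left; apply: sideg; constructor 2.
  move: cp; rewrite le_eqVlt => /predU1P[cp|cp].
    by left; apply: sideg; constructor 3.
  move: pd; rewrite le_eqVlt => /predU1P[pd|pd].
    by left; apply: sideg; constructor 4.
  right; split; first by apply: nbhs_rectangle; apply/andP.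
  have [d1 [c1 [d2 [c2 [J1 J2 c12]]]]] := Jf p.
  have [S1 S2] := is_jet2_sqdist (0, 0) p.
  have M1' := is_jet2D J1 (is_jet2Z (- ep) S1).
  have M2' := is_jet2D J2 (is_jet2Z (- ep) S2).
  do 4 eexists; split; [exact: M1'|exact: M2'|lra].
- by rewrite /= !in_itv.
Qed.

End HarmonicRectangle.

Section LineIntegrals.
Variable K : realType.
Local Notation mu := (@lebesgue_measure K).
Local Open Scope ereal_scope.

Lemma exists_value_le_average (F : K -> \bar K) (I a N : K) : (0 < N)%R ->
  measurable_fun setT F -> (forall x, 0 <= F x) -> \int[mu]_x F x <= I%:E ->
  exists2 s, (a <= s <= a + N)%R & F s <= ((I + 1) / N)%:E.
Proof.
move=> N0 mF F0 FI; apply: contrapT => H.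
(* [I + 1] instead of [I] gives a contradiction with a non-strict bound. *)
have big s : `[a, (a + N)%R]%classic s -> ((I + 1) / N)%:E <= F s.
  move=> /=; rewrite in_itv /= => sa; rewrite leNgt; apply/negP => Fs.
  by apply: H; exists s => //; exact: ltW.
have I0 : (0 <= I)%R by rewrite -lee_fin; apply: le_trans FI; exact: integral_ge0.
suff : (I + 1)%:E <= I%:E by rewrite lee_fin; lra.
apply: le_trans FI.
apply: (@le_trans _ _ (\int[mu]_(x in `[a, (a + N)%R]) F x)); last first.
  by apply: ge0_subset_integral => //; exact: measurable_itv.
apply: (@le_trans _ _ (\int[mu]_(x in `[a, (a + N)%R]) (cst ((I + 1) / N)%:E x))).
  rewrite integral_cst; last exact: measurable_itv.
  rewrite [X in _ * X]lebesgue_measure_itv /= lte_fin ltrDl N0 -EFinB -EFinM addrAC subrr add0r.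
  by rewrite divfK ?gt_eqF.
apply: ge0_le_integral => //.
- by move=> x _; rewrite lee_fin divr_ge0 ?addr_ge0 // ltW.
- exact: measurable_funTS.
Qed.

(** Cauchy-Schwarz in the form [|phi'| <= (k phi'^2 + 1/k) / 2], integrated over
the segment; the parameter [k] will be the scale of the rectangle. *)
Lemma osc_le_energy (phi dphi : K -> K) (a b B k p q : K) : (0 < k)%R ->
  (forall x : K, is_derive x 1%R phi (dphi x)) -> continuous dphi ->
  \int[mu]_x ((dphi x) ^+ 2)%:E <= B%:E ->
  (a <= p <= b)%R -> (a <= q <= b)%R ->
  (`|phi p - phi q| <= (k * B + (b - a) / k) / 2)%R.
Proof.
move=> k0 dphiP cd phiB; wlog : p q / (p < q)%R.
  move=> H pab qab; have [pq|qp|->] := ltgtP p q.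
  - exact: H.
  - by rewrite distrC; exact: H.
  rewrite subrr normr0 divr_ge0 // addr_ge0 //.
    rewrite mulr_ge0 ?(ltW k0) // -lee_fin; apply: le_trans phiB.
    by apply: integral_ge0 => x _; rewrite lee_fin sqr_ge0.
  by rewrite divr_ge0 ?(ltW k0) // subr_ge0; case/andP: qab => aq; apply: le_trans.
move=> pq /andP[ap pb] /andP[aq qb].
(* [psi] dominates the absolute value of the derivative. *)
pose psi x : K := ((k / 2) * dphi x ^+ 2 + (2 * k)^-1)%R.
have psi_ge x (t : K) : (t ^+ 2 = 1 -> t * dphi x <= psi x)%R.
  move=> t1; rewrite -subr_ge0.
  have -> : (psi x - t * dphi x = (k * dphi x - t) ^+ 2 / (2 * k))%R.
    by rewrite sqrrB t1 /psi; field; rewrite gt_eqF.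
  by rewrite divr_ge0 ?sqr_ge0 // mulr_ge0 // ltW.
have cpsi : continuous psi.
  move=> x; apply: cvgD; last exact: cvg_cst.
  by apply: cvgM; [exact: cvg_cst|apply: cvgM; exact: cd].
have intc (g : K -> K) : continuous g -> mu.-integrable `[p, q] (EFin \o g).
  move=> cg; apply: continuous_compact_integrable; first exact: segment_compact.
  exact: continuous_subspaceT.
have psiB : \int[mu]_(x in `[p, q]) (psi x)%:E <= ((k * B + (b - a) / k) / 2)%:E.
  have mpq : measurable (`[p, q]%classic : set K) by exact: measurable_itv.
  have c2 : continuous (fun x => dphi x ^+ 2)%R by move=> x; apply: cvgM; exact: cd.
  under eq_integral do rewrite /psi EFinD EFinM.
  rewrite integralD //; last 2 first.
  - apply: integrableZl => //; exact: intc.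
  - by apply: (intc (cst (2 * k)^-1)%R); exact: cst_continuous.
  rewrite integralZl //; last exact: intc.
  rewrite [X in _ + X](_ : _ = \int[mu]_(x in `[p, q]) cst ((2 * k)^-1)%:E x) // integral_cst //.
  rewrite [X in _ + _ * X]lebesgue_measure_itv /= lte_fin pq -EFinB -EFinM.
  have le1 : \int[mu]_(x in `[p, q]) (dphi x ^+ 2)%:E <= B%:E.
    apply: le_trans phiB; apply: ge0_subset_integral => //.
    - by apply/measurable_EFinP; exact: continuous_measurable_fun.
    - by move=> x _; rewrite lee_fin sqr_ge0.
  have le2 : ((k / 2)%:E * \int[mu]_(x in `[p, q]) (dphi x ^+ 2)%:E <= (k / 2)%:E * B%:E).
    by apply: lee_wpmul2l => //; rewrite lee_fin divr_ge0 // ltW.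
  apply: le_trans (leeD2r _ le2) _.
  rewrite -EFinM -EFinD lee_fin.
  have : ((2 * k)^-1 * (q - p) <= (2 * k)^-1 * (b - a))%R.
    by apply: ler_wpM2l; [rewrite invr_ge0 mulr_ge0 // ltW|lra].
  have -> : ((2 * k)^-1 * (b - a) = (b - a) / k / 2)%R by rewrite invfM; ring.
  lra.
have key (g dg : K -> K) : (forall x : K, is_derive x 1%R g (dg x)) -> continuous dg ->
   (forall x, dg x <= psi x)%R -> (g q - g p <= (k * B + (b - a) / k) / 2)%R.
  move=> Dg cg gpsi; rewrite -lee_fin EFinB; apply: le_trans psiB.
  rewrite -(continuous_FTC2 pq (f := dg) (F := g)).
  - apply: le_integral => //; [exact: intc|exact: intc|].
    by move=> x _; rewrite lee_fin.
  - exact: continuous_subspaceT.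
  - have dg' x : derivable g x 1%R by case: (Dg x).
    have cg' : continuous g.
      by move=> x; apply: differentiable_continuous; apply/derivable1_diffP.
    split; [by move=> x _|apply: cvg_at_right_filter; exact: cg'|apply: cvg_at_left_filter; exact: cg'].
  - by move=> x _; rewrite derive1E; case: (Dg x).
rewrite ler_norml; apply/andP; split.
- rewrite lerNl opprB; apply: (key phi dphi) => // x.
  have := psi_ge x 1%R; rewrite mul1r; apply; exact: expr1n.
- have -> : (phi p - phi q = (- phi) q - (- phi) p)%R by rewrite opprK addrC.
  apply: (key (- phi)%R (- dphi)%R) => [x|x].
  + by apply: continuousN; exact: cd.
  + by have := psi_ge x (-1)%R; rewrite mulN1r sqrrN; apply; exact: expr1n.
Qed.

End LineIntegrals.

(** * Harmonic functions with finite Dirichlet integral *)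

Section FiniteDirichlet.
Variable K : realType.
Implicit Types (f g w : K * K -> K) (p q z : K * K).
Local Notation mu := (@lebesgue_measure K).

(** The product sigma-algebra contains the open sets of the plane because these
are countable unions of rectangles with rational vertices. *)
Lemma open_measurable_prod (O : set (K * K)) : open O -> measurable O.
Proof.
move=> oO.
pose Q (c : rat * rat * (rat * rat)) : set (K * K) :=
  `]ratr c.1.1, ratr c.1.2[%classic `*` `]ratr c.2.1, ratr c.2.2[%classic.
pose F c := if `[< Q c `<=` O >] then Q c else set0.
have -> : O = \bigcup_c F c.
  apply/seteqP; split => [p Op|p [c _]]; last first.
    by rewrite /F; case: asboolP => // QO /QO.
  have [e /= e0 He] := (nbhs_ballP _ _).1 (open_nbhs_nbhs (conj oO Op)).
  have [a] := @rat_in_itvoo K (p.1 - e) p.1 ltac:(by rewrite gtrBl).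
  have [b] := @rat_in_itvoo K p.1 (p.1 + e) ltac:(by rewrite ltrDl).
  have [c] := @rat_in_itvoo K (p.2 - e) p.2 ltac:(by rewrite gtrBl).
  have [d] := @rat_in_itvoo K p.2 (p.2 + e) ltac:(by rewrite ltrDl).
  rewrite !in_itv /= => /andP[d1 d2] /andP[c1 c2] /andP[b1 b2] /andP[a1 a2].
  exists ((a, b), (c, d)) => //; rewrite /F; case: asboolP => [_|[]].
    by rewrite /Q /= !in_itv /= a2 b1 c2 d1.
  move=> z [] /=; rewrite !in_itv /= => /andP[z1 z2] /andP[z3 z4]; apply: He.
  by split => /=; rewrite /ball /= ltr_distl; apply/andP; split; lra.
apply: countable_bigcupT_measurable => [|c]; first exact: countableP.
rewrite /F; case: ifP => // _; rewrite /Q.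
by apply: measurableX; exact: measurable_itv.
Qed.

Lemma continuous_measurable_fun_prod f : continuous f -> measurable_fun setT f.
Proof.
move=> /continuousP cf; apply: (measurability _ (RGenOpens.measurableE K)).
move=> _ [_ [a [b ->] <-]]; rewrite setTI; apply: open_measurable_prod.
exact/cf/interval_open.
Qed.

Lemma continuous_pairl f (b : K) : continuous f -> continuous (fun a => f (a, b)).
Proof.
move=> cf a; apply: (continuous_comp (f := fun a => (a, b))); last exact: cf.
by apply: (@cvg_pair K K K (nbhs a) (nbhs a) (nbhs b) _ _ _ (fun x => x) (fun=> b)); [exact: cvg_id|exact: cvg_cst].
Qed.

Lemma continuous_pairr f (a : K) : continuous f -> continuous (fun b => f (a, b)).
Proof.
move=> cf b; apply: (continuous_comp (f := fun b => (a, b))); last exact: cf.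
by apply: (@cvg_pair K K K (nbhs b) (nbhs a) (nbhs b) _ _ _ (fun=> a) (fun x => x)); [exact: cvg_cst|exact: cvg_id].
Qed.

Lemma is_derive_fst f (x s d : K) :
  is_derive (x, s) e1 f d -> is_derive x 1 (fun x => f (x, s)) d.
Proof.
have -> : (x, s) = x *: e1 + (0, s).
  by congr pair; rewrite /= /(_ *: _) /=; ring.
move=> /is_derive_lineP.
rewrite (_ : (fun t : K => f (t *: e1 + (0, s))) = fun x => f (x, s)) //.
by apply/funext => t; congr f; congr pair; rewrite /= /(_ *: _) /=; ring.
Qed.

Lemma is_derive_snd f (s x d : K) :
  is_derive (s, x) e2 f d -> is_derive x 1 (fun x => f (s, x)) d.
Proof.
have -> : (s, x) = x *: e2 + (s, 0).
  by congr pair; rewrite /= /(_ *: _) /=; ring.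
move=> /is_derive_lineP.
rewrite (_ : (fun t : K => f (t *: e2 + (s, 0))) = fun x => f (s, x)) //.
by apply/funext => t; congr f; congr pair; rewrite /= /(_ *: _) /=; ring.
Qed.

Lemma gradient0_cst f : (forall p, is_derive p e1 f 0) ->
  (forall p, is_derive p e2 f 0) -> forall p q, f p = f q.
Proof.
move=> d1 d2 [x y] [x' y'].
have E1 := is_derive_0_is_cst x x' (fun t => is_derive_fst (d1 (t, y))).
have E2 := is_derive_0_is_cst y y' (fun t => is_derive_snd (d2 (x', t))).
exact: etrans E1 E2.
Qed.

Lemma exists_low_energy_lines (h : K * K -> K) (I N : K) : 0 < N -> continuous h ->
  (forall p, 0 <= h p) -> (\int[(mu \x mu)%E]_p (h p)%:E <= I%:E)%E ->
  (forall a, exists2 s, a <= s <= a + N &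
     (\int[mu]_x (h (x, s))%:E <= ((I + 1) / N)%:E)%E) /\
  (forall a, exists2 s, a <= s <= a + N &
     (\int[mu]_y (h (s, y))%:E <= ((I + 1) / N)%:E)%E).
Proof.
move=> N0 ch h0 hI.
have mh : measurable_fun setT (fun p => (h p)%:E).
  by apply/measurable_EFinP; exact: continuous_measurable_fun_prod.
have h0' p : (0 <= (h p)%:E)%E by rewrite lee_fin.
split=> a.
- apply: (exists_value_le_average (F := fun s => \int[mu]_x (h (x, s))%:E)%E) => //.
  + exact: (measurable_fun_fubini_tonelli_G (m1 := mu) _ mh h0').
  + by move=> s; exact: integral_ge0.
  + by move: hI; rewrite fubini_tonelli2.
- apply: (exists_value_le_average (F := fun s => \int[mu]_x (h (s, x))%:E)%E) => //.
  + exact: (measurable_fun_fubini_tonelli_F (m2 := mu) _ mh h0').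
  + by move=> s; exact: integral_ge0.
  + by move: hI; rewrite fubini_tonelli1.
Qed.

(** On lines with energy at most [(I + 1)/N] and of length at most [4N], the
oscillation bound [(N (I + 1)/N + 4N/N) / 2] does not depend on [N].  Four such
lines enclose the square of half-side [N], so the maximum principle bounds the
function on all squares at once. *)
Lemma harmonic_finite_dirichlet_cst f (G1 G2 : K * K -> K) :
  superharmonic f -> superharmonic (- f) ->
  (forall p, is_derive p e1 f (G1 p)) -> (forall p, is_derive p e2 f (G2 p)) ->
  continuous G1 -> continuous G2 ->
  (\int[(mu \x mu)%E]_p (G1 p ^+ 2 + G2 p ^+ 2)%:E < +oo)%E ->
  forall p q, f p = f q.
Proof.
move=> sf sNf D1 D2 cG1 cG2 fin.
pose h p := G1 p ^+ 2 + G2 p ^+ 2.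
have h0 p : 0 <= h p by rewrite addr_ge0 // sqr_ge0.
have ch : continuous h.
  by move=> p; apply: cvgD; apply: cvgM; (exact: cG1 || exact: cG2).
pose I := fine (\int[(mu \x mu)%E]_p (h p)%:E)%E.
have hI : (\int[(mu \x mu)%E]_p (h p)%:E <= I%:E)%E.
  rewrite fineK // ge0_fin_numE //.
  by apply: integral_ge0 => p _; rewrite lee_fin.
have line1 s x := is_derive_fst (D1 (x, s)).
have line2 s x := is_derive_snd (D2 (s, x)).
pose C := I + 5.
have bounded z : `|f z - f 0| <= 2 * C.
  pose N := 1 + `|z.1| + `|z.2|.
  have N0 : 0 < N by rewrite /N -addrA ltr_pwDl // addr_ge0.
  have [hor ver] := exists_low_energy_lines N0 ch h0 hI.
  have [a /andP[a1 a2] Ia] := ver (- (2 * N)).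
  have [b /andP[b1 b2] Ib] := ver N.
  have [c /andP[c1 c2] Ic] := hor (- (2 * N)).
  have [d /andP[d1 d2] Id] := hor N.
  have half : (N * ((I + 1) / N) + (2 * N - - (2 * N)) / N) / 2 = C / 2.
    by rewrite /C; field; rewrite gt_eqF.
  have osc1 s (x y : K) : (\int[mu]_x (h (x, s))%:E <= ((I + 1) / N)%:E)%E ->
     a <= x <= b -> a <= y <= b -> `|f (x, s) - f (y, s)| <= C / 2.
    move=> Is /andP[x1 x2] /andP[y1 y2]; rewrite -half.
    apply: (osc_le_energy N0 (line1 s)).
    - exact: continuous_pairl.
    - apply: le_trans Is; apply: ge0_le_integral => //.
      + by move=> t _; rewrite lee_fin sqr_ge0.
      + apply/measurable_EFinP; apply: continuous_measurable_fun => t.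
        by apply: cvgM; exact: continuous_pairl.
      + apply/measurable_EFinP; apply: continuous_measurable_fun => t.
        exact: continuous_pairl.
      + by move=> t _; rewrite lee_fin /h lerDl sqr_ge0.
    - by apply/andP; split; lra.
    - by apply/andP; split; lra.
  have osc2 s (x y : K) : (\int[mu]_x (h (s, x))%:E <= ((I + 1) / N)%:E)%E ->
     c <= x <= d -> c <= y <= d -> `|f (s, x) - f (s, y)| <= C / 2.
    move=> Is /andP[x1 x2] /andP[y1 y2]; rewrite -half.
    apply: (osc_le_energy N0 (line2 s)).
    - exact: continuous_pairr.
    - apply: le_trans Is; apply: ge0_le_integral => //.
      + by move=> t _; rewrite lee_fin sqr_ge0.
      + apply/measurable_EFinP; apply: continuous_measurable_fun => t.
        by apply: cvgM; exact: continuous_pairr.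
      + apply/measurable_EFinP; apply: continuous_measurable_fun => t.
        exact: continuous_pairr.
      + by move=> t _; rewrite lee_fin /h lerDr sqr_ge0.
    - by apply/andP; split; lra.
    - by apply/andP; split; lra.
  have side p : a <= p.1 <= b -> c <= p.2 <= d ->
     [\/ p.1 = a, p.1 = b, p.2 = c | p.2 = d] -> `|f p - f (a, c)| <= C.
    have aab : a <= a <= b by rewrite lexx; lra.
    have bab : a <= b <= b by rewrite lexx andbT; lra.
    have ccd : c <= c <= d by rewrite lexx; lra.
    have dcd : c <= d <= d by rewrite lexx andbT; lra.
    have C0 : 0 <= C / 2 by apply: le_trans (osc1 _ _ _ Ic aab aab).
    case: p => x y /= xab ycd; case => ->.
    - by apply: le_trans (osc2 _ _ _ Ia ycd ccd) _; lra.
    - apply: le_trans (ler_distD (f (b, c)) _ _) _.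
      by have := osc2 _ _ _ Ib ycd ccd; have := osc1 _ _ _ Ic bab aab; lra.
    - by apply: le_trans (osc1 _ _ _ Ic xab aab) _; lra.
    - apply: le_trans (ler_distD (f (a, d)) _ _) _.
      by have := osc1 _ _ _ Id xab aab; have := osc2 _ _ _ Ia dcd ccd; lra.
  have inside p : a <= p.1 <= b -> c <= p.2 <= d -> `|f p - f (a, c)| <= C.
    move=> p1 p2; rewrite ler_distl; apply/andP; split.
      apply: (superharmonic_min_rectangle sf _ p1 p2) => q q1 q2 /(side q q1 q2).
      by rewrite ler_distl => /andP[].
    rewrite -lerN2; change (- (f (a, c) + C) <= (- f) p).
    apply: (superharmonic_min_rectangle sNf _ p1 p2) => q q1 q2 /(side q q1 q2).
    by rewrite ler_distl lerN2 => /andP[].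
  have NE : N = 1 + `|z.1| + `|z.2| by [].
  have [n1 n2] := (normr_ge0 z.1, normr_ge0 z.2).
  have z1 : a <= z.1 <= b.
    have := ler_norm z.1; have := lerNnormlW (lexx `|z.1|).
    by move=> *; apply/andP; split; lra.
  have z2 : c <= z.2 <= d.
    have := ler_norm z.2; have := lerNnormlW (lexx `|z.2|).
    by move=> *; apply/andP; split; lra.
  have o1 : a <= (0 : K * K).1 <= b by rewrite (_ : (0 : K * K).1 = 0) //; apply/andP; split; lra.
  have o2 : c <= (0 : K * K).2 <= d by rewrite (_ : (0 : K * K).2 = 0) //; apply/andP; split; lra.
  apply: le_trans (ler_distD (f (a, c)) _ _) _.
  rewrite [X in _ + X]distrC [2 * C]mulr_natl mulr2n.
  by apply: lerD; [exact: inside z z1 z2|exact: inside 0 o1 o2].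
have := superharmonicDcst (2 * C + 1 - f 0) sf => /positive_superharmonic_cst H p q.
apply: (addIr (2 * C + 1 - f 0)); apply: H => {p q} z.
change (0 < f z + (2 * C + 1 - f 0)).
by have := bounded z; rewrite ler_distl => /andP[]; lra.
Qed.

End FiniteDirichlet.

(** * The stationary system on a time slice *)

Section Stationary.
Variable K : realType.
Implicit Types (u : K * (K * K) -> K) (p q z : K * K).

Lemma is_derive_slice u (t : K) p v d :
  is_derive (t, p) (0, v) u d -> is_derive p v (fun p => u (t, p)) d.
Proof.
have E : (fun h : K => h^-1 *: ((u \o shift (t, p)) (h *: (0, v)) - u (t, p)))
   = (fun h : K => h^-1 *: (((fun p => u (t, p)) \o shift p) (h *: v) - u (t, p))).
  apply/funext => h /=; congr (_ *: (u _ - _)).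
  by congr pair; rewrite /= scaler0 add0r.
by move=> [ex val]; split; move: ex val; rewrite /derivable /derive E.
Qed.

(** The regularity used in the sequel: continuity of the map and of its spatial
first derivatives on the slice [t = 0], and the existence of the unmixed second
derivatives. *)
Lemma smooth_slice u : smooth u ->
  [/\ continuous (fun p => u (0, p)),
      continuous (fun p => dx1 u (0, p)) /\ continuous (fun p => dx2 u (0, p)),
      (forall p, is_derive p e1 (fun p => u (0, p)) (dx1 u (0, p))) /\
      (forall p, is_derive p e2 (fun p => u (0, p)) (dx2 u (0, p))) &
      (forall p, is_derive p e1 (fun p => dx1 u (0, p)) (dx1 (dx1 u) (0, p))) /\
      (forall p, is_derive p e2 (fun p => dx2 u (0, p)) (dx2 (dx2 u) (0, p)))].
Proof.
move=> /(_ 2) /= [cu du] d2u.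
have cs (g : K * (K * K) -> K) : continuous g -> continuous (fun p => g (0, p)).
  move=> cg p; apply: (continuous_comp (f := fun p => (0, p))); last exact: cg.
  by apply: (@cvg_pair (K * K) K (K * K) (nbhs p) (nbhs 0) (nbhs p) _ _ _ (fun=> 0) (fun x => x)); [exact: cvg_cst|exact: cvg_id].
have [c1 d1 _] := d2u (0, (1, 0)); have [c2 d2 _] := d2u (0, (0, 1)).
have B1 p : is_derive (0, p) (0, (1, 0)) (dx1 u) (dx1 (dx1 u) (0, p)) :=
  DeriveDef (d1 _ _) erefl.
have B2 p : is_derive (0, p) (0, (0, 1)) (dx2 u) (dx2 (dx2 u) (0, p)) :=
  DeriveDef (d2 _ _) erefl.
have A1 := cs (dx1 u) c1.
have A2 := cs (dx2 u) c2.
split; first exact: cs.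
- exact: conj A1 A2.
- by split=> p; apply: is_derive_slice; apply: DeriveDef => //; exact: du.
- by split=> p; [exact: is_derive_slice (B1 p)|exact: is_derive_slice (B2 p)].
Qed.

Lemma smooth_jet2 u : smooth u -> forall p,
  is_jet2 (fun p => u (0, p)) p e1 (dx1 u (0, p)) (dx1 (dx1 u) (0, p)) /\
  is_jet2 (fun p => u (0, p)) p e2 (dx2 u (0, p)) (dx2 (dx2 u) (0, p)).
Proof.
move=> /smooth_slice[_ _ [d1 d2] [d11 d22]] p; split.
  exists (fun p => dx1 u (0, p)).
  by split; [|by near=> q; exact: d1|exact: d11].
exists (fun p => dx2 u (0, p)).
by split; [|by near=> q; exact: d2|exact: d22].
Unshelve. all: by end_near. Qed.

Lemma stationary_dt u : stationary u -> dt u = cst 0.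
Proof.
move=> su; apply/funext => -[t x]; rewrite /dt /derive /=.
have -> : (fun h : K => h^-1 *: ((u \o shift (t, x)) (h *: (1, (0, 0))) - u (t, x))) = cst 0.
  apply/funext => h /=; rewrite (_ : h *: (1, (0, 0)) + (t, x) = (h + t, x)).
    by rewrite (su _ t) subrr scaler0.
  congr pair; first by rewrite /= [h *: 1]mulr1.
  by rewrite /= (_ : (0, 0) = 0 :> K * K) // scaler0 add0r.
exact: lim_cst.
Qed.

Lemma dt_cst (c : K) : dt (cst c) = cst 0.
Proof. by apply/funext => p; rewrite /dt derive_cst. Qed.

Lemma dx1_cst (c : K) : dx1 (cst c) = cst 0.
Proof. by apply/funext => p; rewrite /dx1 derive_cst. Qed.

Lemma dx2_cst (c : K) : dx2 (cst c) = cst 0.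
Proof. by apply/funext => p; rewrite /dx2 derive_cst. Qed.

Lemma stationary_system (R : K -> K) (l : K) u1 u2 : (forall t, 0 < R t) ->
  classical_solution R l u1 u2 -> stationary u1 -> stationary u2 -> forall p : K * (K * K),
  laplacian u1 p = l / u2 p * grad_dot u1 u2 p /\
  laplacian u2 p = l / (2 * u2 p) * (grad_dot u2 u2 p - grad_dot u1 u1 p).
Proof.
move=> R0 [_ _ u20 sys] s1 s2 p; have := sys p.
rewrite (stationary_dt s1) (stationary_dt s2) dt_cst /=.
have Rp := R0 p.1; have Rn : R p.1 != 0 by rewrite gt_eqF.
have up := u20 p; have un : u2 p != 0 by rewrite gt_eqF.
move=> [E1 E2]; split; apply/eqP; rewrite -subr_eq0; apply/eqP.
  apply: (@mulfI _ (- R p.1 ^- 2)); first by rewrite oppr_eq0 invr_eq0 expf_neq0.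
  by rewrite mulr0 -[RHS]E1; ring.
apply: (@mulfI _ (- R p.1 ^- 2)); first by rewrite oppr_eq0 invr_eq0 expf_neq0.
by rewrite mulr0 -[RHS]E2 expr0n /= subrr; ring.
Qed.

End Stationary.

(** * Targets with l < 2 *)

Section Cases.
Variable K : realType.
Implicit Types (u : K * (K * K) -> K).

Lemma slice_cst u c : stationary u -> (forall p, u (0, p) = c) -> forall P, u P = c.
Proof. by move=> su H [t x]; rewrite (su t 0). Qed.

(** Any exponent between [0] and [(2 - l)/2] makes the power of [u2] a positive
superharmonic function; the proof uses the midpoint. *)
Lemma stationary_height_cst (R : K -> K) (l : K) u1 u2 :
  (forall t, 0 < R t) -> 0 <= l -> l < 2 ->
  classical_solution R l u1 u2 -> stationary u1 -> stationary u2 ->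
  forall p q, u2 (0, p) = u2 (0, q).
Proof.
move=> R0 l0 l2 sol s1 s2.
have sys := stationary_system R0 sol s1 s2.
have [_ sm2 u20 _] := sol.
pose b := (2 - l) / 4.
have b0 : 0 < b by rewrite divr_gt0 // subr_gt0.
pose y (p : K * K) := u2 (0, p).
pose pb : K -> K := fun t => t `^ b.
pose pb1 : K -> K := fun t => b * t `^ (b - 1).
have y0 p : 0 < y p := u20 _.
have dpb (t : K) : 0 < t -> is_derive t 1 pb (pb1 t) by exact: is_derive1_powR.
have dpb1 (t : K) : 0 < t -> is_derive t 1 pb1 (b * ((b - 1) * t `^ (b - 2))).
  move=> t0; have H := is_derive1_powR (b - 1) t0.
  rewrite (_ : b - 2 = b - 1 - 1); last by ring.
  exact: (is_deriveZ b H).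
have [cy _ _ _] := smooth_slice sm2.
have sup : superharmonic (pb \o y).
  split=> p.
    apply: continuous_comp; first exact: cy.
    apply: differentiable_continuous; apply/derivable1_diffP.
    by case: (dpb _ (y0 p)).
  have [J1 J2] := smooth_jet2 sm2 p.
  have np : \forall q \near p, is_derive (y q) 1 pb (pb1 (y q)).
    by near=> q; exact: dpb.
  have M1 := is_jet2_comp np (dpb1 _ (y0 p)) J1.
  have M2 := is_jet2_comp np (dpb1 _ (y0 p)) J2.
  do 4 eexists; split; [exact: M1|exact: M2|].
  have [_ ] := sys (0, p); rewrite /laplacian /grad_dot -/(y p).
  have yn : y p != 0 by rewrite gt_eqF.
  (* Dividing by [y^(b-2)] leaves a polynomial identity. *)
  have powE : y p `^ (b - 1) = y p * y p `^ (b - 2).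
    rewrite -[X in X * _]powRr1 ?ltW // -powRD; last by rewrite (gt_eqF (y0 p)) implybT.
    by congr (_ `^ _); ring.
  rewrite /pb1 powE.
  have := powR_gt0 (b - 2) (y0 p); move: (y p `^ (b - 2)) => w w0.
  set a11 := dx1 (dx1 u2) _; set a22 := dx2 (dx2 u2) _.
  set g1 := dx1 u2 _; set g2 := dx2 u2 _; set f1 := dx1 u1 _; set f2 := dx2 u1 _.
  move=> lap.
  have lap' : y p * (a11 + a22) = l / 2 * ((g1 * g1 + g2 * g2) - (f1 * f1 + f2 * f2)).
    by rewrite lap; field.
  rewrite [X in X <= 0](_ : _ = - (b * w * (b * (g1 ^+ 2 + g2 ^+ 2)
     + l / 2 * (f1 ^+ 2 + f2 ^+ 2)))).
    have sq0 (s t : K) : 0 <= s ^+ 2 + t ^+ 2 by rewrite addr_ge0 ?sqr_ge0.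
    rewrite oppr_le0; apply: mulr_ge0; first exact/ltW/mulr_gt0.
    by apply: addr_ge0; apply: mulr_ge0; [exact: ltW|exact: sq0|exact: divr_ge0|exact: sq0].
  transitivity (b * w * ((b - 1) * (g1 ^+ 2 + g2 ^+ 2) + y p * (a11 + a22))); first by ring.
  by rewrite lap' /b; field.
move=> p q.
have := positive_superharmonic_cst sup (fun p => powR_gt0 b (y0 p)) p q.
move=> /(congr1 (@ln K)) /=; rewrite /pb !ln_powR.
have bn : b != 0 by rewrite gt_eqF.
move=> /(mulfI bn).
by apply: ln_inj; rewrite posrE.
Unshelve. all: by end_near. Qed.

Lemma constant_map_solution (R : K -> K) (l : K) u1 u2 :
  constant_map u1 u2 ->
  [/\ classical_solution R l u1 u2, stationary u1, stationary u2,
     spherically_symmetric u1 /\ spherically_symmetric u2 &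
      forall t : K, (energy l u1 u2 t < +oo)%E].
Proof.
move=> [c1 [c2 [c20 H]]].
have -> : u1 = cst c1 by apply/funext => p; have [] := H p.
have -> : u2 = cst c2 by apply/funext => p; have [] := H p.
have smc (c : K) : smooth (cst c : K * (K * K) -> K).
  move=> k; elim: k c => [|k IH] c /=; first exact: cst_continuous.
  split; first exact: cst_continuous.
    by move=> x v; exact: derivable_cst.
  move=> v; rewrite (_ : (fun x => _) = cst 0); first exact: IH.
  by apply/funext => x; rewrite derive_cst.
split => //.
- split => // p; rewrite /laplacian /grad_dot !(dt_cst, dx1_cst, dx2_cst) /=.
  by split; ring.
- move=> t; rewrite /energy /energy_density.
  under eq_integral do rewrite !(dx1_cst, dx2_cst) /= !mul0r expr0n /= !addr0.
  by rewrite integral0 ltry.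
Qed.

(** With [u2] constant, the second equation reads [l |grad u1|^2 = 0], and for
[l = 0] the first one says that [u1] is harmonic, while the energy is its
Dirichlet integral. *)
Lemma stationary_finite_energy_cst (R : K -> K) (l : K) u1 u2 :
  (forall t, 0 < R t) -> 0 <= l -> l < 2 ->
  classical_solution R l u1 u2 -> stationary u1 -> stationary u2 ->
  (energy l u1 u2 0 < +oo)%E -> constant_map u1 u2.
Proof.
move=> R0 l0 l2 sol s1 s2 fin.
have ycst := stationary_height_cst R0 l0 l2 sol s1 s2.
have sys := stationary_system R0 sol s1 s2.
have [sm1 _ u20 _] := sol.
have u2E : u2 = cst (u2 (0, 0)).
  by apply/funext; apply: slice_cst => // p; exact: ycst.
have d1u2 : dx1 u2 = cst 0 by rewrite u2E dx1_cst.
have d2u2 : dx2 u2 = cst 0 by rewrite u2E dx2_cst.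
suff x_cst : forall p q, u1 (0, p) = u1 (0, q).
  exists (u1 (0, 0)), (u2 (0, 0)); split => // p.
  by split; [apply: slice_cst => // q; exact: x_cst|rewrite {1}u2E].
have [cx [cx1 cx2] [D1 D2] _] := smooth_slice sm1.
have [l_eq0|l_neq0] := eqVneq l 0.
  apply: (harmonic_finite_dirichlet_cst _ _ D1 D2 cx1 cx2).
  - split=> // p; have [J1 J2] := smooth_jet2 sm1 p.
    do 4 eexists; split; [exact: J1|exact: J2|].
    by have [+ _] := sys (0, p); rewrite /laplacian l_eq0 !mul0r => ->.
  - split=> [p|p]; first by apply: continuousN; exact: cx.
    have [J1 J2] := smooth_jet2 sm1 p; rewrite -scaleN1r.
    do 4 eexists; split; [exact: (is_jet2Z _ J1)|exact: (is_jet2Z _ J2)|].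
    by have [+ _] := sys (0, p); rewrite /laplacian l_eq0 !mul0r -mulrDr => ->; rewrite mulr0.
  - have dens p : energy_density l u1 u2 (0, p) =
        dx1 u1 (0, p) ^+ 2 + dx2 u1 (0, p) ^+ 2.
      have pw : u2 (0, p) `^ (l / 2) = 1 by rewrite l_eq0 mul0r powRr0.
      rewrite /energy_density pw d1u2 d2u2 /cst.
      move: (dx1 u1 _) (dx2 u1 _) => a1 a2.
      by rewrite !divr1 expr0n /= !addr0.
    apply: le_lt_trans fin; rewrite /energy le_eqVlt; apply/orP; left; apply/eqP.
    by apply: eq_integral => p _; rewrite dens.
have grad0 p : dx1 u1 (0, p) = 0 /\ dx2 u1 (0, p) = 0.
  have [_] := sys (0, p); rewrite /laplacian /grad_dot d1u2 d2u2 dx1_cst dx2_cst /=.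
  have un : u2 (0, p) != 0 by rewrite gt_eqF.
  move: (dx1 u1 _) (dx2 u1 _) => a1 a2.
  rewrite !mul0r !addr0 sub0r => /esym/eqP.
  rewrite mulf_eq0 oppr_eq0 mulf_eq0 invr_eq0 mulf_eq0 (negPf l_neq0) (negPf un) pnatr_eq0 /=.
  rewrite -!expr2 paddr_eq0 ?sqr_ge0 // !expf_eq0 /= => /andP[/eqP-> /eqP->].
  by [].
apply: (@gradient0_cst _ (fun p => u1 (0, p))) => p.
- by have := D1 p; rewrite (grad0 p).1.
- by have := D2 p; rewrite (grad0 p).2.
Qed.

End Cases.

(** * Spherically symmetric maps into the hyperbolic plane *)

Section Radial.
Variable K : realType.
Implicit Types (u : K * (K * K) -> K).

Lemma is_derive_unique (f : K -> K) (x d d' : K) :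
  is_derive x 1 f d -> is_derive x 1 f d' -> d = d'.
Proof. by move=> [_ <-] [_ <-]. Qed.

Lemma radial_polar u : spherically_symmetric u -> forall t x,
  u (t, x) = u (t, (enorm x, 0)).
Proof.
move=> rad t x; apply: rad; rewrite {2}/enorm /= expr0n addr0 sqrtr_sqr.
by rewrite ger0_norm // sqrtr_ge0.
Qed.

(** Along the line through [(r, 0)] orthogonal to the axis, [u] is the profile
evaluated at [sqrt (r^2 + s^2)], so its derivative is the derivative of the
profile times [s / sqrt (r^2 + s^2)], which at [s = 0] vanishes and has
derivative [1 / r]. *)
Lemma radial_laplacian u (r : K) : smooth u -> spherically_symmetric u -> 0 < r ->
  dx2 u (0, (r, 0)) = 0 /\ dx2 (dx2 u) (0, (r, 0)) = dx1 u (0, (r, 0)) / r.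
Proof.
move=> sm rad r0; have [cu [c1 c2] [d1 d2] [d11 d22]] := smooth_slice sm.
pose f (t : K) := u (0, (t, 0)); pose A (t : K) := dx1 u (0, (t, 0)).
have df (t : K) : is_derive t 1 f (A t) := is_derive_fst (d1 (t, 0)).
have dA (t : K) : is_derive t 1 A (dx1 (dx1 u) (0, (t, 0))) := is_derive_fst (d11 (t, 0)).
pose rho (s : K) := Num.sqrt (r ^+ 2 + s ^+ 2).
have rp (s : K) : 0 < r ^+ 2 + s ^+ 2 by rewrite ltr_pwDl ?exprn_gt0 // sqr_ge0.
have rho0 s : 0 < rho s by rewrite sqrtr_gt0.
have rho00 : rho 0 = r by rewrite /rho expr0n addr0 sqrtr_sqr gtr0_norm.
have drho (s : K) : is_derive s 1 rho (s / rho s).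
  have H1 := is_derive1_sqrt (rp s).
  have H2 : is_derive s 1 (fun s : K => r ^+ 2 + s ^+ 2) (2 * s).
    by apply: is_derive_eq; rewrite /= /(_ *: _) /=; ring.
  have H := is_derive1_comp (g := fun s : K => r ^+ 2 + s ^+ 2) H1 H2.
  apply: (is_derive_eq H); rewrite -/(rho s); field.
  by rewrite gt_eqF.
pose D (s : K) := dx2 u (0, (r, s)).
have DE s : D s = A (rho s) * (s / rho s).
  apply: is_derive_unique (is_derive_snd (d2 (r, s))) _.
  have := is_derive1_comp (df (rho s)) (drho s).
  by congr (is_derive _ _ _ _); apply/funext => t /=; rewrite /f (radial_polar rad 0 (r, t)).
split; first by rewrite -/(D 0) DE mul0r mulr0.
apply: (is_derive_unique (is_derive_snd (d22 (r, 0)))).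
rewrite -/D (_ : D = (fun s => A (rho s) * (rho s)^-1 * s)); last first.
  by apply/funext => s; rewrite DE; ring.
have rho0n : rho 0 != 0 by rewrite rho00 gt_eqF.
have H1 := is_derive1_comp (dA (rho 0)) (drho 0).
have H2 := is_deriveV rho0n (drho 0).
have H := is_deriveM (is_deriveM H1 H2) (is_derive_id 0 (1 : K)).
apply: (is_derive_eq H); rewrite /= !/(_ *: _) /= rho00.
rewrite !mulr1 mul0r addr0.
by change (A (rho 0) / rho 0 = A r / r); rewrite rho00.
Qed.

(** The quantity [F = r^2 (u1'^2 + u2'^2) / u2^2] is the squared length of the
derivative with respect to [log r], that is, the energy of a geodesic in the
hyperbolic plane parametrised by [log r]; hence it is conserved.  At [r = 0] it
vanishes since the derivatives are bounded there. *)
Lemma radial_gradient_eq0 (R : K -> K) u1 u2 : (forall t, 0 < R t) ->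
  classical_solution R 2 u1 u2 -> stationary u1 -> stationary u2 ->
  spherically_symmetric u1 -> spherically_symmetric u2 -> forall r, 0 < r ->
  dx1 u1 (0, (r, 0)) = 0 /\ dx1 u2 (0, (r, 0)) = 0.
Proof.
move=> R0 sol s1 s2 rad1 rad2 r r0.
have sys := stationary_system R0 sol s1 s2.
have [sm1 sm2 u20 _] := sol.
have [cu1 [cx1 _] [d1 _] [d11 _]] := smooth_slice sm1.
have [cu2 [cx2 _] [d2 _] [d22 _]] := smooth_slice sm2.
pose A1 (t : K) := dx1 u1 (0, (t, 0)); pose A2 (t : K) := dx1 u2 (0, (t, 0)).
pose Y (t : K) := u2 (0, (t, 0)).
pose B1 (t : K) := dx1 (dx1 u1) (0, (t, 0)); pose B2 (t : K) := dx1 (dx1 u2) (0, (t, 0)).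
have dA1 (t : K) : is_derive t 1 A1 (B1 t) := is_derive_fst (d11 (t, 0)).
have dA2 (t : K) : is_derive t 1 A2 (B2 t) := is_derive_fst (d22 (t, 0)).
have dY (t : K) : is_derive t 1 Y (A2 t) := is_derive_fst (d2 (t, 0)).
have Y0 (t : K) : 0 < Y t := u20 _.
have Yn (t : K) : Y t != 0 by rewrite gt_eqF.
pose F (t : K) := t ^+ 2 * (A1 t ^+ 2 + A2 t ^+ 2) / Y t ^+ 2.
have dF (t : K) : is_derive t 1 F (2 * t * (A1 t ^+ 2 + A2 t ^+ 2) / Y t ^+ 2
   + t ^+ 2 * (2 * A1 t * B1 t + 2 * A2 t * B2 t) / Y t ^+ 2
   - 2 * t ^+ 2 * (A1 t ^+ 2 + A2 t ^+ 2) * A2 t / Y t ^+ 3).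
  have Y2n : Y t ^+ 2 != 0 by rewrite expf_neq0.
  have HV := is_deriveV (f := Y ^+ 2 : K -> K) Y2n (is_deriveX 2 (dY t)).
  have HA := is_deriveD (is_deriveX 2 (dA1 t)) (is_deriveX 2 (dA2 t)).
  have H := is_deriveM (is_deriveM (is_deriveX 2 (is_derive_id t (1 : K))) HA) HV.
  apply: (is_derive_eq H); rewrite /= !/(_ *: _) /=.
  have e2 (g : K -> K) : (g ^+ 2) t = g t ^+ 2 by [].
  rewrite -[(A1 ^+ 2 + A2 ^+ 2) t]/(A1 t ^+ 2 + A2 t ^+ 2) !e2.
  by rewrite -[((id : K -> K) ^+ 2 * (A1 ^+ 2 + A2 ^+ 2)) t]/(t ^+ 2 * (A1 t ^+ 2 + A2 t ^+ 2)); field.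
have F' (t : K) : 0 < t -> is_derive t 1 F 0.
  move=> t0; have tn : t != 0 by rewrite gt_eqF.
  apply: (is_derive_eq (dF t)).
  have [E1 E2] := sys (0, (t, 0)).
  move: E1 E2; rewrite /laplacian /grad_dot.
  have [-> ->] := radial_laplacian sm1 rad1 t0.
  have [-> ->] := radial_laplacian sm2 rad2 t0.
  rewrite -/(A1 t) -/(A2 t) -/(B1 t) -/(B2 t) -/(Y t).
  have := Yn t; move: (A1 t) (A2 t) (B1 t) (B2 t) (Y t) => a1 a2 b1 b2 y yn E1 E2.
  have -> : b1 = 2 / y * (a1 * a2) - a1 / t.
    by apply: (addIr (a1 / t)); rewrite E1 subrK mulr0 addr0.
  have -> : b2 = (a2 ^+ 2 - a1 ^+ 2) / y - a2 / t.
    by apply: (addIr (a2 / t)); rewrite E2 subrK; field.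
  by field; rewrite yn tn.
have cF : {within `[0, r], continuous F}.
  by apply: derivable_within_continuous => x _; have [] := dF x.
have [c _] := MVT (df := cst 0) r0 (fun x xr => F' x ltac:(by move: xr; rewrite in_itv => /andP[])) cF.
rewrite mul0r => /eqP; rewrite subr_eq0 => /eqP.
rewrite [F 0]/F expr0n !mul0r /F => /eqP.
rewrite mulf_eq0 invr_eq0 expf_eq0 (negPf (Yn r)) orbF mulf_eq0 expf_eq0 gt_eqF //=.
rewrite -/(A1 r) -/(A2 r); move: (A1 r) (A2 r) => a1 a2.
by rewrite paddr_eq0 ?sqr_ge0 // !expf_eq0 /= => /andP[/eqP-> /eqP->].
Qed.

Lemma radial_cst u : smooth u -> spherically_symmetric u -> stationary u ->
  (forall r, 0 < r -> dx1 u (0, (r, 0)) = 0) -> forall p, u p = u (0, (0, 0)).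
Proof.
move=> sm rad st d0; apply: slice_cst => // x.
rewrite (radial_polar rad).
have [_ _ [d1 _] _] := smooth_slice sm.
have df (t : K) := is_derive_fst (d1 (t, 0)).
have : 0 <= enorm x by exact: sqrtr_ge0.
rewrite le_eqVlt => /predU1P[<-//|r0].
have cf : {within `[0, enorm x], continuous (fun t : K => u (0, (t, 0)))}.
  by apply: derivable_within_continuous => t _; have [] := df t.
have [c] := MVT r0 (fun t _ => df t) cf.
rewrite in_itv /= => /andP[c0 _]; rewrite d0 // mul0r => /eqP.
by rewrite subr_eq0 => /eqP.
Qed.

End Radial.

Theorem lemma4p3 (K : realType) (R : K -> K)
    (R_smooth : smooth R) (R_gt0 : forall t : K, 0 < R t) :
  (forall l : K, 0 <= l -> l < 2 ->
     forall u1 u2 : K * (K * K) -> K,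
       [/\ classical_solution R l u1 u2,
           stationary u1, stationary u2 &
           forall t : K, (energy l u1 u2 t < +oo)%E]
       <-> constant_map u1 u2)
  /\
  (forall u1 u2 : K * (K * K) -> K,
     [/\ classical_solution R 2 u1 u2,
         stationary u1, stationary u2,
         spherically_symmetric u1 /\ spherically_symmetric u2 &
         forall t : K, (energy 2 u1 u2 t < +oo)%E]
     <-> constant_map u1 u2).
Proof.
split=> [l l0 l2 u1 u2|u1 u2]; split.
- move=> [sol s1 s2 fin].
  exact: (stationary_finite_energy_cst R_gt0 l0 l2 sol s1 s2 (fin 0)).
- by move=> /(constant_map_solution R l)[sol s1 s2 _ fin].
- move=> [sol s1 s2 [rad1 rad2] _].
  have grad0 := radial_gradient_eq0 R_gt0 sol s1 s2 rad1 rad2.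
  have [sm1 sm2 u20 _] := sol.
  exists (u1 (0, (0, 0))), (u2 (0, (0, 0))); split; first exact: u20.
  by move=> p; split; apply: radial_cst => // r r0; have [] := grad0 r r0.
- exact: constant_map_solution.
Qed.
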